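(* Consider the Downward-Closed Secretary problem in which all item values satisfy $y_i\in\{0,1\}$. There is a deterministic online algorithm for this problem that achieves a competitive ratio of $O(\log n)$.
   Context: Downward-Closed Secretary: there are $n$ items with values $y_i\ge 0$ and a downward-closed family $\mathcal{F}$ of subsets of the items (the feasible sets); both the values and $\mathcal{F}$ are chosen adversarially. The algorithm receives $n$ as input (but not $\mathcal{F}$ or the values). The items arrive in a uniformly random order. Starting with $W=\emptyset$, when an item arrives the algorithm observes its value and all feasible sets that it forms together with previously arrived items, and then decides immediately and irrevocably whether to add it to $W$, subject to $W$ remaining in $\mathcal{F}$. The algorithm's value is $\sum_{i\in W}y_i$. The competitive ratio is the worst case, over instances, of $\max_{S\in\mathcal{F}}\sum_{i\in S}y_i$ divided by the expected value of the algorithm (expectation over the random arrival order). *)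

(* Defs.v *)
From HB Require Import structures.
From mathcomp Require Import all_boot all_order all_algebra fingroup perm.
From mathcomp Require Import boolp classical_sets reals ereal exp.

Set Implicit Arguments.
Unset Strict Implicit.
Unset Printing Implicit Defensive.

Import Order.TTheory GRing.Theory Num.Theory.

Local Open Scope ring_scope.

(* The empty set is required to be feasible: the algorithm starts with W = set0
   and must keep W feasible. *)
Definition downward_closed (T : finType) (F : {set {set T}}) : Prop :=
  finset.set0 \in F /\ forall S S' : {set T}, S \subset S' -> S' \in F -> S \in F.

Record instance (R : realType) (n : nat) := Instance {
  value : 'I_n -> R;
  feasible : {set {set 'I_n}};
  value_ge0 : forall i, 0 <= value i;
  feasible_dc : downward_closed feasible
}.

Definition binary (R : realType) (n : nat) (I : instance R n) : Prop :=
  forall i, value I i = 0 \/ value I i = 1.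

(* An arrival order is a permutation s : 'S_n, where s t is the item arriving at
   time t (times are counted from 0). *)
Definition arrived n (s : 'S_n) (t : 'I_n) (j : 'I_t.+1) : 'I_n :=
  s (widen_ord (ltn_ord t) j).

(* Everything observed up to and including time t. Items are identified by their
   arrival times only, so an algorithm sees neither the adversary's labels nor
   anything about items that have not arrived yet. *)
Definition observed_values (R : realType) n (I : instance R n) (s : 'S_n)
    (t : 'I_n) : {ffun 'I_t.+1 -> R} :=
  [ffun j => value I (arrived s j)].

Definition observed_feasible (R : realType) n (I : instance R n) (s : 'S_n)
    (t : 'I_n) : {set {set 'I_t.+1}} :=
  [set S : {set 'I_t.+1} | [set arrived s j | j in S] \in feasible I].

(* A deterministic online algorithm knows n and decides at each time t, from the
   observations so far, whether to accept the item arriving at time t. Its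
   earlier decisions are functions of these observations, so they need not be
   passed to it. *)
Definition online_algorithm (R : realType) : Type :=
  forall (n : nat) (t : 'I_n),
    {ffun 'I_t.+1 -> R} -> {set {set 'I_t.+1}} -> bool.

Section Run.
Variables (R : realType) (A : online_algorithm R) (n : nat) (I : instance R n).

Definition accepts (s : 'S_n) (t : 'I_n) : bool :=
  A (observed_values I s t) (observed_feasible I s t).

(* The set W after the first k arrivals. *)
Definition selected (s : 'S_n) (k : nat) : {set 'I_n} :=
  [set s t | t : 'I_n & (t < k)%N && accepts s t].

Definition keeps_feasible : Prop :=
  forall (s : 'S_n) (k : nat), (k <= n)%N -> selected s k \in feasible I.

Definition alg_value (s : 'S_n) : R := \sum_(i in selected s n) value I i.

Definition expected_value : R := (\sum_(s : 'S_n) alg_value s) / (n`!)%:R.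

(* Values are nonnegative and set0 is feasible, so the default 0 does not affect
   the maximum. *)
Definition opt_value : R :=
  \big[Num.max/0]_(S in feasible I) \sum_(i in S) value I i.

(* With the division of \bar R, the ratio is +oo if only the denominator is 0,
   and 0 / 0 = 0: instances of optimal value 0 impose no constraint. *)
Definition instance_ratio : \bar R := (opt_value%:E / expected_value%:E)%E.

End Run.

Definition competitive_ratio (R : realType) (A : online_algorithm R) (n : nat)
    (P : set (instance R n)) : \bar R :=
  ereal_sup [set instance_ratio A I | I in P]%classic.

(* Main.v *)
Require Import Defs.
From mathcomp Require Import all_boot all_order all_algebra fingroup perm.
From mathcomp Require Import boolp classical_sets reals ereal exp.
From mathcomp Require Import fintype finset zify ring lra.

(**
Only items of value 1 matter; let k be the optimum. Fix K = 80p of order k and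
cut both halves of the arrival sequence into K blocks A_0, A_1, ... (sample) and
B_0, B_1, ... of equal length. Say that W extends by q if W together with some
set of at least q sample items, at most one from each block, is feasible. While
block B_b arrives, for b < 20p, the algorithm accepts at most one item x, and
does so iff W + x extends by 60p - b - 1 using only the blocks A_i with i > b.
The threshold decreases by exactly one per block, and dropping one block costs
at most one element of a rainbow set, so W keeps extending by 60p - b into the
blocks A_i, i >= b, for free.

Fix the sequence of accepted items in advance, so that W is a function of b
alone, and call a block good at time b if one of its items would pass the test.
At every b at least half of the A_i, i >= b, would be good in the place of A_b.
Swapping A_b with a random later A_i shows that A_b is good for a constant
fraction of the b. On the other hand the test only looks at later sample blocks,
so swapping A_b with B_b shows that "A_b is good and B_b is not" cannot happen m
times with probability more than 2^-m. Hence a fixed sequence with few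
acceptances occurs with probability exponentially small in p. There are at most
n^O(j) sequences with j acceptances, so with high probability the algorithm
accepts more than p / O(log n) items. If no p >= 4 fits the sample, the algorithm
just takes the first feasible item of the second half.
*)

Set Implicit Arguments.
Unset Strict Implicit.
Unset Printing Implicit Defensive.

Import Order.TTheory GRing.Theory Num.Theory.

(** This replaces conditional expectation. Translation by each [t i] permutes the group and fixes
    the weight [g], so [f] may be averaged over the translates before it is summed. A bound [c] on
    every such average then factors out. *)
Lemma sum_mulg_avg (R : realFieldType) (gT : finGroupType) (J : finType)
    (D : {set J}) (t : J -> gT) (f g : gT -> R) (c : R) :
  (0 < #|D|)%N ->
  (forall s, (0 <= g s)%R) ->
  (forall i s, i \in D -> g (t i * s)%g = g s) ->
  (forall s, (\sum_(i in D) f (t i * s)%g <= c * #|D|%:R)%R) ->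
  (\sum_s f s * g s <= c * \sum_s g s)%R.
Proof.
move=> D0 g0 gt fc.
have D0R : (0 < #|D|%:R :> R)%R by rewrite ltr0n.
rewrite -(ler_pM2l D0R).
have -> : (#|D|%:R * \sum_s f s * g s =
           \sum_s (\sum_(i in D) f (t i * s)%g) * g s)%R.
  under [RHS]eq_bigr do rewrite big_distrl /=.
  rewrite exchange_big /= mulr_natl -sumr_const.
  apply: eq_bigr => i iD.
  rewrite (reindex_inj (mulgI (t i))) /=.
  by apply: eq_bigr => s _; rewrite gt.
rewrite mulrA (mulrC #|D|%:R)%R mulr_sumr.
by apply: ler_sum => s _; apply: ler_wpM2r.
Qed.

(** * Rainbow extensions *)

Section RainbowExtension.
Variables (T : finType) (F : {set {set T}}).
Hypothesis Fdc : downward_closed F.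
Implicit Types (C : {set {set T}}) (W D Q : {set T}) (q : nat).

(** The blocks form a set rather than an indexed family, so exchanging two of them leaves the
    predicate unchanged. *)
Definition rainbow_ext (C : {set {set T}}) (W : {set T}) (q : nat) : bool :=
  [exists Z : {set T}, [&& q <= #|Z|, Z \subset cover C,
     [forall D in C, #|Z :&: D| <= 1] & Z :|: W \in F]].

Lemma rainbow_extP C W q :
  reflect (exists Z : {set T}, [/\ q <= #|Z|, Z \subset cover C,
     forall D, D \in C -> #|Z :&: D| <= 1 & Z :|: W \in F])
  (rainbow_ext C W q).
Proof.
apply: (iffP existsP) => -[Z].
  by move=> /and4P[? ? /forall_inP ? ?]; exists Z.
by move=> [? ? ? ?]; exists Z; apply/and4P; split=> //; apply/forall_inP.
Qed.

Lemma rainbow_ext_feasible C W q : rainbow_ext C W q -> W \in F.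
Proof.
move=> /rainbow_extP[Z [_ _ _ ZW]].
by apply: (Fdc.2 _ _ _ ZW); apply: subsetUr.
Qed.

(** Removing [D] from the witness costs at most one element. The two inclusions also allow [D] to
    stay in [C'], which happens when blocks coincide as sets. *)
Lemma rainbow_ext_drop C C' D W q :
  C \subset D |: C' -> C' \subset C ->
  D \in C -> rainbow_ext C W q.+1 -> rainbow_ext C' W q.
Proof.
move=> CC' C'C DC /rainbow_extP[Z [qZ ZC Z1 ZF]].
apply/rainbow_extP; exists (Z :\: D); split.
- have := cardsID D Z; have := Z1 _ DC; lia.
- apply/subsetP => x /setDP[xZ xD].
  have /bigcupP[E EC xE] := subsetP ZC _ xZ.
  have := subsetP CC' _ EC; rewrite !inE => /orP[/eqP ED|EC'].
    by rewrite -ED xE in xD.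
  by apply/bigcupP; exists E.
- move=> E EC'; apply: leq_trans (Z1 _ (subsetP C'C _ EC')).
  by apply: subset_leq_card; apply: setSI; apply: subsetDl.
- by apply: (Fdc.2 _ _ _ ZF); apply: setSU; apply: subsetDl.
Qed.

Definition has_good (C : {set {set T}}) (W Q : {set T}) (q : nat) : bool :=
  [exists x in Q, rainbow_ext C (x |: W) q].

(** Every element of the witness makes its block good: adding it to [W] does not change the union
    with the witness, and dropping its block costs only one element. No block holds two elements of
    the witness, so there are at least as many good blocks as witness elements. *)
Lemma rainbow_ext_hits (J : finType) (X : J -> {set T}) (D : {set J})
    (C : J -> {set {set T}}) W q :
  rainbow_ext (X @: D) W q.+1 ->
  (forall i, i \in D -> X @: D \subset X i |: C i) ->
  (forall i, i \in D -> C i \subset X @: D) ->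
  q < #|[set i in D | has_good (C i) W (X i) q]|.
Proof.
move=> /rainbow_extP[Z [qZ ZC Z1 ZF]] DC CD.
apply: (leq_trans qZ).
set H := [set i in D | _].
have Zsum : #|Z| <= \sum_(i in D) #|Z :&: X i|.
  apply: (@leq_trans #|\bigcup_(i in D) (Z :&: X i)|).
    apply: subset_leq_card; apply/subsetP => x xZ.
    have /bigcupP[E /imsetP[i iD ->] xE] := subsetP ZC _ xZ.
    by apply/bigcupP; exists i => //; rewrite inE xZ.
  elim/big_rec2: _ => [|i m A _ IH]; first by rewrite cards0.
  by apply: leq_trans (leq_card_setU _ _) _; rewrite leq_add2l.
apply: (leq_trans Zsum).
rewrite -sum1_card big_mkcond [X in _ <= X]big_mkcond /=.
apply: leq_sum => i _; case: ifP => // iD.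
rewrite /H inE iD /=.
have [->|/set0Pn[x /setIP[xZ xX]]] := eqVneq (Z :&: X i) set0; first by rewrite cards0.
have XiD : X i \in X @: D by apply: imset_f.
have -> : has_good (C i) W (X i) q; last exact: Z1.
apply/exists_inP; exists x => //.
apply: (@rainbow_ext_drop (X @: D) _ (X i)) => //; [exact: DC|exact: CD|].
apply/rainbow_extP; exists Z; split => //.
have xZ1 : [set x] :|: Z = Z by apply/finset.setUidPr; rewrite sub1set.
by rewrite setUCA setUA xZ1.
Qed.

End RainbowExtension.

(** * Blocks of consecutive arrivals and block swaps *)

Section Blocks.
Variable n : nat.
Implicit Types (s : 'S_n) (L a b : nat).

Lemma nat_of_insubd (u : 'I_n) (m : nat) :
  (insubd u m : nat) = if m < n then m else u.
Proof. exact: val_insubd. Qed.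

Definition block s L a : {set 'I_n} := [set s u | u : 'I_n & a <= u < a + L].

Definition block_swap_fun L a b (u : 'I_n) : 'I_n :=
  if a <= u < a + L then insubd u (u - a + b)
  else if b <= u < b + L then insubd u (u - b + a) else u.

(** Choosing a permutation that agrees with the function makes the swap total: it is the identity
    when [block_swap_fun] is not a permutation. *)
Definition block_swap L a b : 'S_n :=
  odflt 1%g [pick t : 'S_n | [forall u, t u == block_swap_fun L a b u]].

(** Equality is allowed because the random later block may be the block itself. *)
Definition apart L a b := (a == b) || (a + L <= b) || (b + L <= a).

Lemma block_swap_funE L a b (u : 'I_n) : a + L <= n -> b + L <= n ->
  (block_swap_fun L a b u : nat) =
  if a <= u < a + L then u - a + b else if b <= u < b + L then u - b + a else u.
Proof.
move=> aL bL; rewrite /block_swap_fun; have un := ltn_ord u.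
case: ifP => [uab|_]; last case: ifP => [uab|//];
  by rewrite nat_of_insubd ifT //; lia.
Qed.

Lemma block_swapE L a b u : apart L a b -> a + L <= n -> b + L <= n ->
  block_swap L a b u = block_swap_fun L a b u.
Proof.
rewrite /apart => abL aL bL; rewrite /block_swap.
case: pickP => [t /forallP/(_ u)/eqP //|].
have fK : involutive (block_swap_fun L a b).
  move=> v; apply: val_inj; rewrite /= block_swap_funE //.
  have := block_swap_funE v aL bL; set w := block_swap_fun L a b v.
  by repeat (case: ifP => ?); lia.
move=> /(_ (perm (inv_inj fK)))/forallP []; move=> v.
by rewrite permE.
Qed.

Lemma block_swapL L a b s : apart L a b -> a + L <= n -> b + L <= n ->
  block (block_swap L a b * s) L a = block s L b.
Proof.
move=> abL aL bL; apply/setP => x; apply/imsetP/imsetP => -[u]; rewrite !inE => uab ->.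
  exists (block_swap L a b u); last by rewrite permM.
  by rewrite !inE block_swapE // block_swap_funE // uab; lia.
have un := ltn_ord u.
have ltu : u - b + a < n by lia.
exists (Ordinal ltu); first by rewrite inE /=; lia.
rewrite permM block_swapE //; congr (s _); apply: val_inj.
rewrite [RHS]block_swap_funE //=; repeat (case: ifP => ?); lia.
Qed.

Lemma block_swapC L a b : apart L a b -> a + L <= n -> b + L <= n ->
  block_swap L a b = block_swap L b a.
Proof.
move=> abL aL bL; apply/permP => u; rewrite !block_swapE //; last first.
  by move: abL; rewrite /apart; lia.
apply: val_inj; rewrite /= !block_swap_funE //; move: abL; rewrite /apart => abL.
by repeat (case: ifP => ?); lia.
Qed.

Lemma block_swapR L a b s : apart L a b -> a + L <= n -> b + L <= n ->
  block (block_swap L a b * s) L b = block s L a.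
Proof.
move=> abL aL bL; rewrite block_swapC // block_swapL //.
by move: abL; rewrite /apart; lia.
Qed.

Lemma block_swap_id L a b c s : apart L a b -> a + L <= n -> b + L <= n ->
  (c + L <= a) || (a + L <= c) -> (c + L <= b) || (b + L <= c) ->
  block (block_swap L a b * s) L c = block s L c.
Proof.
move=> abL aL bL ca cb; apply: eq_in_imset => u; rewrite inE => uc.
rewrite permM block_swapE // /block_swap_fun.
by rewrite !ifF //; lia.
Qed.

Definition blocks_from s L (K b : nat) : {set {set 'I_n}} :=
  (fun i : 'I_K => block s L (i * L)) @: [set i : 'I_K | b <= i].

Lemma mem_blocks_from s L (K b i : nat) :
  i < K -> b <= i -> block s L (i * L) \in blocks_from s L K b.
Proof.
by move=> iK bi; apply/imsetP; exists (Ordinal iK); rewrite ?inE.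
Qed.

Lemma blocks_fromP s L (K b : nat) D :
  reflect (exists2 i, b <= i < K & D = block s L (i * L))
    (D \in blocks_from s L K b).
Proof.
apply: (iffP imsetP) => [[i]|[i /andP[bi iK] ->]].
  by rewrite inE => bi ->; exists i => //; rewrite bi /=.
by exists (Ordinal iK); rewrite ?inE.
Qed.

End Blocks.

Section BlockIndex.
Variable n : nat.
Implicit Types (s : 'S_n) (L h K b i j m : nat).

Lemma apart_mul L i j : apart L (i * L) (j * L).
Proof.
by rewrite /apart; case: (ltngtP i j) => [ij|ij|->]; rewrite ?eqxx //;
  apply/orP; [left; apply/orP; right|right]; nia.
Qed.

Lemma blocks_from_sub s L K b m : b <= m ->
  blocks_from s L K m \subset blocks_from s L K b.
Proof.
move=> bm; apply/subsetP => D /blocks_fromP[i /andP[mi iK] ->].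
by apply: mem_blocks_from => //; apply: leq_trans mi.
Qed.

Lemma eq_blocks_from s s' L K b :
  (forall j, b <= j < K -> block s L (j * L) = block s' L (j * L)) ->
  blocks_from s L K b = blocks_from s' L K b.
Proof.
by move=> e; apply: eq_in_imset => i; rewrite inE => bi; apply: e; rewrite bi /=.
Qed.

Lemma blocks_from_swap s L K b m i :
  K * L <= n -> b <= m -> m <= i -> i < K ->
  blocks_from (block_swap n L (m * L) (i * L) * s) L K b = blocks_from s L K b.
Proof.
move=> KL bm mi iK; set t := block_swap _ _ _ _.
have mL : m * L + L <= n by nia.
have iL : i * L + L <= n by nia.
have ap := apart_mul L m i.
(* On block indices the swap is the transposition of [m] and [i], which preserves the range from [b]
   to [K]. *)
pose tau j := if j == m then i else if j == i then m else j.
have tauE j : b <= j < K -> b <= tau j < K by rewrite /tau; repeat case: ifP; lia.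
have tauK j : tau (tau j) = j.
  rewrite /tau; case: (eqVneq j m) => [->|jm]; first by rewrite eqxx; case: eqP; lia.
  by case: (eqVneq j i) => [->|ji]; rewrite ?eqxx // (negbTE jm) (negbTE ji).
have bE j : block (t * s) L (j * L) = block s L (tau j * L).
  rewrite /tau; case: eqP => [->|jm]; first exact: block_swapL.
  case: eqP => [->|ji]; first exact: block_swapR.
  by apply: block_swap_id => //; nia.
apply/setP => D; apply/blocks_fromP/blocks_fromP => -[j jb ->].
  by exists (tau j); rewrite ?bE //; apply: tauE.
by exists (tau j); rewrite ?bE ?tauK //; apply: tauE.
Qed.

End BlockIndex.

(** * The probability of a fixed schedule of acceptances *)

Section Schedule.
Variables (R : realFieldType) (n : nat) (F : {set {set 'I_n}}).
Hypothesis Fdc : downward_closed F.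
Variables (p L h : nat).
Hypothesis hK : 80 * p * L <= h.
Hypothesis hn : h + h <= n.
Variable w : nat -> option 'I_n.
Implicit Types (s : 'S_n) (b i m : nat).

Definition prior (b : nat) : {set 'I_n} := [set x | [exists i : 'I_b, w i == Some x]].

Definition slack_inv (s : 'S_n) (b : nat) : bool :=
  rainbow_ext F (blocks_from s L (80 * p) b) (prior b) (60 * p - b).

(** The start [a] of the tested block is separate from the time [b], so that sample and selection
    blocks can take the same test. *)
Definition good_block (s : 'S_n) (b a : nat) : bool :=
  has_good F (blocks_from s L (80 * p) b.+1) (prior b) (block s L a) (60 * p - b.+1).

Local Notation goodA s b := (good_block s b (b * L)).
Local Notation goodB s b := (good_block s b (h + b * L)).

(* A block with an acceptance needs no clause of its own: of its acceptance only the
   invariant at the following block is used. *)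
Definition follows (s : 'S_n) : bool :=
  [forall b : 'I_(20 * p), slack_inv s b && (~~ w b ==> ~~ goodB s b)].

Local Open Scope ring_scope.

(** If [s] follows the schedule and G counts its good sample blocks, the products of [phi] and [psi]
    over all b < 20p are 2^G and 2^-G. They control large and small G respectively. *)
Let phi s b : R := (w b || ~~ goodB s b)%:R * 2 ^+ goodA s b.
Let psi s b : R := (slack_inv s b)%:R * 2^-1 ^+ goodA s b.

Let phi_ge0 s b : 0 <= phi s b.
Proof. by rewrite mulr_ge0 ?ler0n ?exprn_ge0. Qed.

Let psi_ge0 s b : 0 <= psi s b.
Proof. by rewrite mulr_ge0 ?ler0n ?exprn_ge0 ?invr_ge0. Qed.

(* The swap of A_b with B_b leaves the factors after b alone, because they see only
   later blocks. If exactly one of the two blocks is good, the factor at b is 2 for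
   one order and 0 for the other. *)
Lemma phi_sum m b : (b <= m)%N -> (m <= 80 * p)%N ->
  \sum_s \prod_(b <= i < m) phi s i <= n`!%:R * \prod_(b <= i < m) 2 ^+ (w i : bool).
Proof.
move=> bm mK; have [d bd] : exists d, (m - b)%N = d by exists (m - b)%N.
elim: d b bm bd => [|d IH] b bm bd.
  have -> : b = m by lia.
  rewrite [leLHS](eq_bigr (fun=> 1)); last by move=> s _; rewrite big_geq.
  by rewrite big_geq // mulr1 sumr_const card_Sn.
have bltm : (b < m)%N by lia.
rewrite [leLHS](eq_bigr (fun s => phi s b * \prod_(b.+1 <= i < m) phi s i)); last first.
  by move=> s _; rewrite big_ltn.
rewrite [X in _ <= _ * X]big_ltn // mulrCA.
apply: le_trans (_ : 2 ^+ (w b : bool) * \sum_s \prod_(b.+1 <= i < m) phi s i <= _); last first.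
  by rewrite ler_pM2l ?exprn_gt0 //; apply: IH => //; lia.
pose sw := block_swap n L (b * L) (h + b * L).
have bK : (b < 80 * p)%N by lia.
have bL : (b * L + L <= h)%N by nia.
have aL : (b * L + L <= n)%N by lia.
have hL : (h + b * L + L <= n)%N by lia.
have ap : apart L (b * L) (h + b * L) by rewrite /apart; lia.
have keepA s j : (b < j)%N -> (j < 80 * p)%N ->
    block (sw * s)%g L (j * L) = block s L (j * L).
  by move=> bj jK; apply: block_swap_id => //; nia.
have keepB s j : (b < j)%N -> (j < 80 * p)%N ->
    block (sw * s)%g L (h + j * L) = block s L (h + j * L).
  by move=> bj jK; apply: block_swap_id => //; nia.
have keepC s j : (b < j)%N ->
    blocks_from (sw * s)%g L (80 * p) j = blocks_from s L (80 * p) j.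
  move=> bj; apply: eq_blocks_from => k /andP[jk kK].
  by apply: keepA => //; apply: leq_trans jk.
(* The average is over the two orders [s] and [sw * s]. *)
apply: (@sum_mulg_avg _ _ _ [set: bool] (fun c : bool => if c then 1%g else sw)).
- by rewrite cardsT card_bool.
- by move=> s; apply: prodr_ge0.
- move=> [] s _; first by rewrite mul1g.
  rewrite !big_nat; apply: eq_bigr => j /andP[bj jm].
  by rewrite /phi /good_block keepA ?keepB ?keepC //; lia.
- move=> s; rewrite cardsT card_bool (eq_bigl xpredT); last by move=> x; rewrite inE.
  rewrite big_bool /= mul1g.
  have -> : phi (sw * s)%g b = (w b || ~~ goodA s b)%:R * 2 ^+ goodB s b.
    by rewrite /phi /good_block block_swapL // block_swapR // keepC.
  (* With an acceptance both terms are at most 2. Without one they are 1 and 1, 2 and 0, or 0 and 0,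
     so their average is at most 1. *)
  rewrite /phi; case: (w b) => [x|] /=; case: (goodA s b); case: (goodB s b);
    rewrite /= ?expr1 ?expr0; lra.
Qed.

(* The factors before m see the blocks A_i, i >= m, only as a set, so they are
   invariant under the swap of A_m with a later A_i. *)
Lemma psi_sum m : (m <= 20 * p)%N ->
  \sum_s \prod_(0 <= i < m) psi s i <= n`!%:R * (3 / 4) ^+ m.
Proof.
elim: m => [_|m IH mp].
  rewrite [leLHS](eq_bigr (fun=> 1)); last by move=> s _; rewrite big_geq.
  by rewrite expr0 mulr1 sumr_const card_Sn.
rewrite [leLHS](eq_bigr (fun s => psi s m * \prod_(0 <= i < m) psi s i)); last first.
  by move=> s _; rewrite big_nat_recr //= mulrC.
rewrite exprS mulrCA.
apply: le_trans (_ : 3 / 4 * \sum_s \prod_(0 <= i < m) psi s i <= _); last first.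
  by rewrite ler_pM2l; [apply: IH; lia|lra].
have KLn : (80 * p * L <= n)%N by lia.
pose D := [set i : 'I_(80 * p) | (m <= i)%N].
have cD : #|D| = (80 * p - m)%N.
  rewrite -sum1_card big_mkcond /= (eq_bigr (fun i : 'I__ => (m <= i)%N : nat)).
    by elim: (80 * p)%N => [|N IHN]; rewrite ?big_ord0 // big_ord_recr /= IHN; lia.
  by move=> i _; rewrite inE; case: leqP.
apply: (@sum_mulg_avg R _ _ D (fun i : 'I__ => block_swap n L (m * L) (i * L))
  (psi^~ m) (fun s => \prod_(0 <= i < m) psi s i) (3 / 4)).
- by rewrite cD; lia.
- by move=> s; apply: prodr_ge0.
- move=> i s; rewrite inE => mi; have iK := ltn_ord i.
  have mL : (m * L + L <= n)%N by nia.
  have iL : (i * L + L <= n)%N by nia.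
  rewrite !big_nat; apply: eq_bigr => j /andP[_ jm].
  rewrite /psi /slack_inv /good_block !blocks_from_swap //; try lia.
  rewrite (block_swap_id _ (apart_mul L m i) mL iL) //; nia.
(* The swaps preserve the invariant at [m], so if it fails all terms vanish. *)
- move=> s; case inv: (slack_inv s m); last first.
    rewrite big1; first by apply: mulr_ge0; [lra|exact: ler0n].
    move=> i; rewrite inE => mi.
    by rewrite /psi /slack_inv blocks_from_swap // -/(slack_inv s m) inv mul0r.
  set G := [set i in D | goodA (block_swap n L (m * L) (i * L) * s)%g m].
  have -> : \sum_(i in D) psi (block_swap n L (m * L) (i * L) * s)%g m
      = #|D|%:R - #|G|%:R / 2.
    rewrite (eq_bigr (fun i : 'I__ => 1 - 2^-1 * (i \in G)%:R)); last first.
      move=> i iD; have mi : (m <= i)%N by rewrite inE in iD.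
      rewrite /psi /slack_inv blocks_from_swap // -/(slack_inv s m) inv mul1r.
      by rewrite /G inE iD /=; case: (goodA _ m); rewrite /= ?expr1 ?expr0; lra.
    rewrite sumrB sumr_const -mulr_sumr -natr_sum -big_mkcondr /= mulrC.
    by congr (_ - _%:R * _); rewrite -sum1_card; apply: eq_bigl => i;
      rewrite /G !inE andbA andbb.
  have : (60 * p - m <= #|G|)%N.
    have Eq : (60 * p - m = (60 * p - m.+1).+1)%N by lia.
    rewrite Eq; move: inv; rewrite /slack_inv Eq /blocks_from -/D => inv.
    pose t (i : 'I_(80 * p)) := block_swap n L (m * L) (i * L).
    (* After the swap the tested block is A_i, and the blocks after [m] are the remaining ones. *)
    have tE (i : 'I_(80 * p)) : i \in D -> block (t i * s)%g L (m * L) = block s L (i * L).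
      rewrite inE => mi; have := ltn_ord i => iK.
      by rewrite block_swapL //; [exact: apart_mul|nia|nia].
    pose C (i : 'I_(80 * p)) := blocks_from (t i * s)%g L (80 * p) m.+1.
    have := rainbow_ext_hits Fdc (C := C) inv.
    move=> H; apply: leq_trans (H _ _) _.
    - move=> i; rewrite inE => mi; have iK := ltn_ord i.
      rewrite -/(blocks_from s L (80 * p) m) -(blocks_from_swap s KLn (leqnn m) mi iK).
      apply/subsetP => E /blocks_fromP[j /andP[mj jK] ->]; rewrite inE.
      have [<-|mj'] := eqVneq m j; first by rewrite -/(t i) tE ?inE // eqxx.
      by rewrite mem_blocks_from ?orbT //; lia.
    - move=> i; rewrite inE => mi; have iK := ltn_ord i.
      rewrite -/(blocks_from s L (80 * p) m) -(blocks_from_swap s KLn (leqnn m) mi iK).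
      exact: blocks_from_sub.
    - apply: subset_leq_card; apply/subsetP => i; rewrite !inE => /andP[mi].
      by rewrite /good_block -/(t i) tE ?inE // mi.
  rewrite cD => GE.
  (* Since m < 20p, 60p - m is at least half of 80p - m. A good block halves its term, so the
     average is at most 1 - 1/4. *)
  have : (80 * p - m <= 2 * #|G|)%N by lia.
  rewrite -(ler_nat R) natrM; lra.
Qed.

Lemma pow_3_4_20 : 2 ^+ 4 * (3 / 4) ^+ 20 <= 16^-1 :> R.
Proof.
have -> : (3 / 4 : R) ^+ 20 = ((3 / 4) ^+ 5) ^+ 4 by rewrite -exprM.
have h5 : (3 / 4 : R) ^+ 5 <= 6 / 25 by rewrite !exprS expr0; lra.
have h0 : 0 <= (3 / 4 : R) ^+ 5 by apply: exprn_ge0; lra.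
have : ((3 / 4 : R) ^+ 5) ^+ 4 <= (6 / 25) ^+ 4 by apply: lerXn2r; rewrite ?nnegrE //; lra.
by move=> h4; rewrite !exprS expr0 in h4 *; lra.
Qed.

(** Either at most 4p sample blocks are good, and 2^(4p) times the product of [psi] is at least 1,
    or more are, and 2^-(4p) times the product of [phi] is at least 1. The indicator is thus below
    the sum of the two. *)
Lemma follows_sum :
  \sum_s (follows s)%:R <= n`!%:R * 16^-1 ^+ p * 2 * 2 ^+ (\sum_(b < 20 * p) w b)%N :> R.
Proof.
(* This cutoff balances the two cases: 2^-m is 16^-p, and 2^m (3/4)^(20p) is at most 16^-p by
   [pow_3_4_20]. *)
pose m := (4 * p)%N.
have p2 k : 0 < 2 ^+ k :> R by rewrite exprn_gt0.
have bound s : (follows s)%:R <= 2 ^+ m * \prod_(0 <= i < 20 * p) psi s i +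
    2^-1 ^+ m * \prod_(0 <= i < 20 * p) phi s i.
  have pr0 (f : nat -> R) : (forall i, 0 <= f i) -> 0 <= \prod_(0 <= i < 20 * p) f i.
    by move=> f0; apply: prodr_ge0.
  case fs: (follows s); last first.
    by apply: addr_ge0; apply: mulr_ge0; rewrite ?exprn_ge0 ?invr_ge0 ?pr0.
  pose G := (\sum_(0 <= i < 20 * p) goodA s i)%N.
  have fi i : (i < 20 * p)%N -> slack_inv s i /\ (w i || ~~ goodB s i).
    move=> ip; move/forallP/(_ (Ordinal ip)): fs => /= /andP[-> /implyP H].
    by split=> //; case: (w i : bool) H => //= ->.
  have -> : \prod_(0 <= i < 20 * p) psi s i = 2^-1 ^+ G.
    rewrite expr_sum !big_nat; apply: eq_bigr => i /andP[_ /fi[H _]].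
    by rewrite /psi H mul1r.
  have -> : \prod_(0 <= i < 20 * p) phi s i = 2 ^+ G.
    rewrite expr_sum !big_nat; apply: eq_bigr => i /andP[_ /fi[_ H]].
    by rewrite /phi H mul1r.
  rewrite !exprVn; case: (leqP G m) => Gm.
    apply: ler_wpDr; first by rewrite mulr_ge0 ?invr_ge0 ?ltW.
    by rewrite ler_pdivlMr // mul1r ler_eXn2l ?ltr1n.
  apply: ler_wpDl; first by rewrite mulr_ge0 ?invr_ge0 ?ltW.
  by rewrite mulrC ler_pdivlMr // mul1r ler_eXn2l ?ltr1n // ltnW.
apply: le_trans (ler_sum _ (fun s _ => bound s)) _.
rewrite big_split /= -!mulr_sumr.
have hpsi := psi_sum (leqnn (20 * p)).
have hphi := phi_sum (leq0n (20 * p)) (leq_mul (isT : (20 <= 80)%N) (leqnn p)).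
have e16 : 2^-1 ^+ m = 16^-1 ^+ p :> R.
  by rewrite /m exprM; congr (_ ^+ _); rewrite !exprS expr0; lra.
set f := n`!%:R; set S := (\sum_(b < 20 * p) w b)%N.
have f0 : 0 <= f by rewrite /f ler0n.
have eS : \prod_(0 <= i < 20 * p) 2 ^+ (w i : bool) = 2 ^+ S :> R.
  by rewrite big_mkord /S expr_sum.
rewrite eS -/f in hphi.
have S1 : 1 <= 2 ^+ S :> R by apply: exprn_ege1; lra.
apply: le_trans (_ : f * 16^-1 ^+ p + f * 16^-1 ^+ p * 2 ^+ S <= _).
  apply: lerD.
    apply: le_trans (_ : 2 ^+ m * (f * (3 / 4) ^+ (20 * p)) <= _).
      by rewrite ler_pM2l.
    rewrite mulrCA ler_wpM2l // /m !exprM -exprMn; apply: lerXn2r.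
    - by rewrite nnegrE mulr_ge0 ?exprn_ge0 //; lra.
    - by rewrite nnegrE invr_ge0.
    - exact: pow_3_4_20.
  by rewrite e16 (mulrC f) -mulrA; apply: ler_wpM2l hphi; rewrite exprn_ge0 ?invr_ge0.
have x0 : 0 <= f * 16^-1 ^+ p by rewrite mulr_ge0 ?exprn_ge0 ?invr_ge0.
by nra.
Qed.

End Schedule.

(** * Union bound over schedules with few acceptances *)

Section FewAcceptances.
Variables (R : realFieldType) (n : nat) (F : {set {set 'I_n}}).
Hypothesis Fdc : downward_closed F.
Variables (p L h : nat).
Hypothesis hK : 80 * p * L <= h.
Hypothesis hn : h + h <= n.
Hypothesis n0 : 0 < n.

Definition schedule_at (f : {ffun 'I_(20 * p) -> option 'I_n}) (b : nat) : option 'I_n :=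
  if insub b is Some i then f i else None.

Local Open Scope ring_scope.

(** The weight factorises over blocks; in each, [None] contributes 1 and each of the n items
    contributes [y]. *)
Lemma schedule_weight_sum (y : R) :
  \sum_(f : {ffun 'I_(20 * p) -> option 'I_n}) y ^+ (\sum_i (f i : bool))%N
  = (1 + n%:R * y) ^+ (20 * p).
Proof.
rewrite [LHS](eq_bigr (fun f : {ffun 'I_(20 * p) -> option 'I_n} =>
  \prod_i y ^+ (f i : bool))); last first.
  by move=> f _; rewrite expr_sum.
rewrite -(bigA_distr_bigA (fun _ o => y ^+ (isSome o))) /=.
rewrite prodr_const card_ord; congr (_ ^+ _).
rewrite (bigD1 None) //= expr0; congr (_ + _).
rewrite (reindex_omap Some id) => [|[]//].
rewrite (eq_bigl xpredT) => [|i]; last by rewrite eqxx.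
by rewrite sumr_const card_ord mulr_natl.
Qed.

(** The number n^O(k) of schedules appears as the last factor. The weights leave (17/16)^(20p),
    which is at most 4^p and weakens 16^-p to 4^-p. *)
Lemma few_acceptances (k : nat) :
  \sum_s [exists f : {ffun 'I_(20 * p) -> option 'I_n},
    (\sum_i (f i : bool) <= k)%N && follows F p L h (schedule_at f) s]%:R
  <= n`!%:R * 4^-1 ^+ p * 2 * (32 * n%:R) ^+ k :> R.
Proof.
pose W (f : {ffun 'I_(20 * p) -> option 'I_n}) := (\sum_i (f i : bool))%N.
apply: le_trans (_ : \sum_s \sum_(f | (W f <= k)%N)
    (follows F p L h (schedule_at f) s)%:R <= _).
  apply: ler_sum => s _; case: existsP => [[f /andP[fk ff]]|_]; last first.
    by apply: sumr_ge0 => f _; exact: ler0n.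
  by rewrite (bigD1 f) //= ff ler_wpDr // sumr_ge0 // => g _; exact: ler0n.
rewrite exchange_big /=.
have nR : 0 < n%:R :> R by rewrite ltr0n.
(* Weighting a schedule by (32 n)^(k - acceptances), which is at least 1 on the
   schedules that count, makes the sum over all schedules factorise over blocks. *)
pose y : R := (32 * n%:R)^-1.
have y0 : 0 < y by rewrite invr_gt0 mulr_gt0.
have c0 : 0 < n`!%:R * 16^-1 ^+ p * 2 :> R.
  by rewrite !mulr_gt0 ?exprn_gt0 ?invr_gt0 ?ltr0n ?fact_gt0.
apply: le_trans (_ : \sum_f n`!%:R * 16^-1 ^+ p * 2 *
  ((32 * n%:R) ^+ k * (2 * y) ^+ W f) <= _).
  rewrite big_mkcond /=; apply: ler_sum => f _; case: ifP => [Wk|_]; last first.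
    apply: mulr_ge0; first exact: ltW.
    by apply: mulr_ge0; apply: exprn_ge0; apply: mulr_ge0; rewrite ?ltW.
  apply: le_trans (follows_sum _ Fdc hK hn _) _.
  rewrite ler_pM2l //.
  have -> : (\sum_(b < 20 * p) schedule_at f b = W f)%N.
    by apply: eq_bigr => i _; rewrite /schedule_at valK.
  rewrite (exprMn _ 2 y) mulrCA ler_peMr ?exprn_ge0 // /y exprVn.
  rewrite ler_pdivlMr ?exprn_gt0 ?mulr_gt0 // mul1r.
  apply: ler_weXn2l => //.
  have n1 : 1 <= n%:R :> R by rewrite ler1n.
  by lra.
rewrite -!mulr_sumr schedule_weight_sum.
(* The 2 is the factor per acceptance in [follows_sum], and y = 1 / (32 n). *)
have -> : 1 + n%:R * (2 * y) = 17 / 16.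
  by rewrite /y; field; lra.
rewrite -!mulrA ler_pM2l ?ltr0n ?fact_gt0 //.
rewrite [leRHS]mulrCA [leLHS]mulrCA ler_pM2l //.
rewrite [X in X <= _](_ : _ =
  (32 * n%:R) ^+ k * (16^-1 ^+ p * (17 / 16) ^+ (20 * p))); last by ring.
rewrite [leRHS]mulrC ler_wpM2l ?exprn_ge0 ?mulr_ge0 // exprM -exprMn.
apply: lerXn2r.
- by rewrite nnegrE mulr_ge0 ?exprn_ge0 ?invr_ge0 //; lra.
- by rewrite nnegrE invr_ge0.
have -> : (17 / 16 : R) ^+ 20 = ((17 / 16) ^+ 5) ^+ 4 by rewrite -exprM.
have h5 : (17 / 16 : R) ^+ 5 <= 136 / 100 by rewrite !exprS expr0; lra.
have h0 : 0 <= (17 / 16 : R) ^+ 5 by apply: exprn_ge0; lra.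
have : ((17 / 16 : R) ^+ 5) ^+ 4 <= (136 / 100) ^+ 4 by apply: lerXn2r; rewrite ?nnegrE //; lra.
have e4 : (136 / 100 : R) ^+ 4 <= 4 by rewrite !exprS expr0; lra.
by move=> h4; lra.
Qed.

End FewAcceptances.

(** * A large feasible set is visible in the sample *)

Section SampleValid.
Variables (R : realFieldType) (n : nat).
Implicit Types (s : 'S_n) (T : {set 'I_n}).

(** Sampling without replacement: if the other positions of [r] avoid [T], all of [T] lies in the
    remaining positions. A random one of these then avoids [T] with probability at most 1 - #|T| /
    n. *)
Lemma avoid_sum T (r : seq 'I_n) : uniq r ->
  (\sum_(s : 'S_n) (all (fun u => s u \notin T) r)%:R
   <= n`!%:R * (1 - #|T|%:R / n%:R) ^+ size r :> R)%R.
Proof.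
elim: r => [_|t r IH] /=.
  by rewrite (eq_bigr (fun=> 1%R)) ?expr0 ?mulr1 // sumr_const card_Sn.
move=> /andP[tr ur].
have n0 : (0 < n%:R :> R)%R by rewrite ltr0n; apply: leq_ltn_trans (ltn_ord t).
have Tn : (#|T|%:R <= n%:R :> R)%R.
  by rewrite ler_nat -[X in _ <= X]card_ord; apply: max_card.
have c0 : (0 <= 1 - #|T|%:R / n%:R :> R)%R by rewrite subr_ge0 ler_pdivrMr // mul1r.
pose g s : R := (all (fun u => s u \notin T) r)%:R%R.
(* The indicator [g] is doubled: one copy is the invariant weight, the other restricts the averaged
   factor to orders where the bound holds. *)
rewrite (eq_bigr (fun s => (s t \notin T)%:R * g s * g s)%R); last first.
  by move=> s _; rewrite /g; case: (_ \notin _); case: all; rewrite ?mulr0 ?mulr1 ?mul0r.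
rewrite exprS mulrCA.
apply: le_trans (_ : (1 - #|T|%:R / n%:R) * \sum_(s : 'S_n) g s <= _)%R; last first.
  by apply: ler_wpM2l => //; apply: IH.
pose D := [set i | i \notin r].
have tD : t \in D by rewrite inE.
have gt i s : i \in D -> g (tperm t i * s)%g = g s.
  rewrite inE => ir; congr ((nat_of_bool _)%:R)%R; apply: eq_in_all => u ur'.
  rewrite permM tpermD //; first by apply: contraNneq tr => ->.
  by apply: contraNneq ir => ->.
apply: (@sum_mulg_avg R _ _ D (fun i => tperm t i) (fun s => (s t \notin T)%:R * g s)%R).
- by apply/card_gt0P; exists t.
- by move=> s; rewrite /g ler0n.
- exact: gt.
move=> s; rewrite (eq_bigr (fun i => (s i \notin T)%:R * g s)%R); last first.
  by move=> i iD; rewrite gt // permM tpermL.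
rewrite -mulr_suml -natr_sum -big_mkcondr /= sum1_card.
case gs: (all (fun u => s u \notin T) r); last first.
  by rewrite /g gs mulr0 mulr_ge0.
rewrite /g gs mulr1.
have cD : #|[pred i in D | s i \notin T]| + #|T| = #|D|.
  rewrite -(cardID [pred i | s i \in T] D) addnC; congr (_ + _).
    rewrite -(card_imset _ (@perm_inj _ (s^-1)%g)); apply: eq_card => i.
    rewrite !inE; apply/imsetP/andP => [[x xT ->]|[iD iT]].
      rewrite permKV xT; split=> //; apply/negP => /(allP gs).
      by rewrite permKV xT.
    by exists (s i) => //; rewrite permK.
  by apply: eq_card => i; rewrite !inE andbC.
have Dn : (#|D|%:R <= n%:R :> R)%R.
  by rewrite ler_nat -[X in _ <= X]card_ord; apply: max_card.
rewrite -cD natrD in Dn *.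
set a := (#|_|%:R)%R in Dn *; set b := (#|_|%:R)%R in Dn * .
rewrite mulrBl mul1r -addrA lerDl subr_ge0 -mulrA ler_piMr //.
by rewrite mulrC ler_pdivrMr // mul1r.
Qed.

(** It yields (1 - x)^m <= 1/8 once m x >= 7, without exponentials. *)
Lemma bernoulli_le (x : R) (m : nat) : (0 <= x <= 1)%R ->
  ((1 - x) ^+ m * (1 + m%:R * x) <= 1)%R.
Proof.
move=> /andP[x0 x1]; elim: m => [|m IH]; first by rewrite expr0 mul0r addr0 mulr1.
apply: le_trans IH; rewrite exprSr -mulrA; apply: ler_wpM2l.
  by apply: exprn_ge0; lra.
rewrite -natr1; have m0 : (0 <= m%:R :> R)%R by rewrite ler0n.
by nra.
Qed.

Lemma block_index_inj s L i j x :
  x \in block s L (i * L) -> x \in block s L (j * L) -> i = j.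
Proof.
move=> /imsetP[u]; rewrite inE => ui -> /imsetP[v]; rewrite inE => vj /perm_inj uv.
by subst v; case: (ltngtP i j) => // ij; nia.
Qed.

Variable F : {set {set 'I_n}}.
Hypothesis Fdc : downward_closed F.

(** One element of [T] from each of the at least 60p blocks that meet [T] forms the witness. *)
Lemma few_misses_rainbow_ext s T L (p : nat) : T \in F ->
  #|[set i : 'I_(80 * p) | [disjoint block s L (i * L) & T]]| <= 20 * p ->
  rainbow_ext F (blocks_from s L (80 * p) 0) set0 (60 * p).
Proof.
move=> TF miss; set M := [set i | _] in miss.
have hit (i : 'I_(80 * p)) : exists o : option 'I_n,
    if o is Some x then x \in block s L (i * L) :&: T else i \in M.
  case: (boolP (i \in M)) => [iM|]; first by exists None.
  rewrite inE -setI_eq0 => /set0Pn[x xi]; by exists (Some x).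
have [c hc] := fin_all_exists hit.
pose Z := [set x | [exists i, c i == Some x]].
have ZP x : reflect (exists i, c i = Some x) (x \in Z).
  by rewrite inE; apply: (iffP existsP) => -[i /eqP ?]; exists i.
have ZI i x : c i = Some x -> x \in block s L (i * L) /\ x \in T.
  by move=> e; have := hc i; rewrite e => /setIP.
apply/rainbow_extP; exists Z; split.
- have MZ : #|~: M| <= #|Z|.
    have : [set Some x | x in Z] = [set c i | i in ~: M].
      apply/setP => o; apply/imsetP/imsetP => [[x /ZP[i ix] ->]|[i iM ->]].
        exists i => //; rewrite inE; apply/negP => iM.
        have [xi xT] := ZI _ _ ix.
        move: iM; rewrite inE -setI_eq0 => /eqP e.
        by have := in_set0 x; rewrite -e inE xi xT.
      have := hc i; case e: (c i) => [x|]; last by move: iM; rewrite inE => /negP.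
      by move=> _; exists x => //; apply/ZP; exists i.
    move/(congr1 (fun A : {set option 'I_n} => #|A|)).
    rewrite card_imset; last by move=> ? ? [].
    move=> ->; rewrite card_in_imset // => i j iM jM.
    move: iM; rewrite inE => iM; have := hc i.
    case e: (c i) => [x|]; last by rewrite (negbTE iM).
    move=> _ /esym e'; apply/val_inj.
    by apply: (@block_index_inj s L _ _ x); [case: (ZI _ _ e)|case: (ZI _ _ e')].
  have e : #|M| + #|~: M| = 80 * p by rewrite cardsC card_ord.
  have arith (a b z : nat) : a <= 20 * p -> a + b = 80 * p -> b <= z -> 60 * p <= z by lia.
  exact: arith miss e MZ.
- apply/subsetP => x /ZP[i /ZI[xi _]]; apply/bigcupP.
  by exists (block s L (i * L)) => //; apply: mem_blocks_from.
- move=> D /blocks_fromP[j /andP[_ jK] ->].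
  rewrite leqNgt; apply/negP => /card_gt1P[x [y [/setIP[xZ xj] /setIP[yZ yj] xy]]].
  have [i ix] := ZP _ xZ; have [k ky] := ZP _ yZ.
  have [xi _] := ZI _ _ ix; have [yk _] := ZI _ _ ky.
  have ij := block_index_inj xi xj; have kj := block_index_inj yk yj.
  have ik : i = k by apply: val_inj; rewrite /= ij kj.
  by move: ky; rewrite -ik ix => -[e]; rewrite e eqxx in xy.
- rewrite setU0; apply: (Fdc.2 _ _ _ TF); apply/subsetP => x /ZP[i ix].
  by case: (ZI _ _ ix).
Qed.

(** A block misses [T] with probability at most 1/8, so 10p of the 80p blocks are missed in
    expectation. By Markov's inequality, more than 20p are missed with probability at most 1/2. *)
Lemma sample_valid_sum T (p : nat) : T \in F -> 0 < p -> 2240 * p <= #|T| ->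
  (n`!%:R / 2 <= \sum_(s : 'S_n) (rainbow_ext F
     (blocks_from s (n./2 %/ (80 * p)) (80 * p) 0) set0 (60 * p))%:R :> R)%R.
Proof.
move=> TF p0 pT; set L := n./2 %/ _.
pose V (s : 'S_n) := rainbow_ext F (blocks_from s L (80 * p) 0) set0 (60 * p).
have Tn : #|T| <= n by rewrite -[X in _ <= X]card_ord; apply: max_card.
have n0 : 0 < n by lia.
(* Halving n and rounding the block length down lose a factor of at most 4. *)
have LK : n <= 4 * (L * (80 * p)).
  have := divn_eq n./2 (80 * p); rewrite -/L.
  have := ltn_pmod n./2 (_ : 0 < 80 * p); rewrite muln_gt0 p0 => /(_ isT).
  have : 0 < L by rewrite divn_gt0; lia.
  by have := odd_double_half n; nia.
have Ln : 80 * p * L <= n by have := leq_trunc_div n./2 (80 * p); rewrite -/L; lia.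
pose miss s := #|[set i : 'I_(80 * p) | [disjoint block s L (i * L) & T]]|.
have nV s : ((20 * p)%:R * (~~ V s)%:R <= (miss s)%:R :> R)%R.
  case: (boolP (V s)) => [_|/negP nV]; first by rewrite mulr0 ler0n.
  rewrite mulr1 ler_nat leqNgt; apply/negP => lt; apply: nV.
  by apply: few_misses_rainbow_ext TF _; apply: ltnW.
have one (i : 'I_(80 * p)) :
    (\sum_(s : 'S_n) [disjoint block s L (i * L) & T]%:R <= n`!%:R / 8 :> R)%R.
  pose P := [seq u : 'I_n <- enum 'I_n | i * L <= u < i * L + L].
  have sP : size P = L.
    rewrite size_filter -(count_map val (fun u => i * L <= u < i * L + L)) val_enum_ord.
    have iK := ltn_ord i; have iL : i * L + L <= n by nia.
    have -> : n = (i * L + L) + (n - (i * L + L)) by lia.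
    rewrite iotaD count_cat iotaD count_cat.
    rewrite (eq_in_count (a2 := pred0)) ?count_pred0 => [|u]; last by rewrite mem_iota /=; lia.
    rewrite (eq_in_count (a2 := predT)) ?count_predT => [|u]; last by rewrite mem_iota /=; lia.
    rewrite (eq_in_count (a2 := pred0)) ?count_pred0 => [|u]; last by rewrite mem_iota /=; lia.
    by rewrite size_iota; lia.
  rewrite (eq_bigr (fun s => (all (fun u => s u \notin T) P)%:R)%R); last first.
    move=> s _; congr ((nat_of_bool _)%:R)%R.
    rewrite -setI_eq0; apply/eqP/allP => [e u|H].
      rewrite mem_filter => /andP[ui _]; apply/negP => uT.
      have := in_set0 (s u); rewrite -e inE uT andbT => /negP[].
      by apply: imset_f; rewrite inE.
    apply/setP => x; rewrite !inE; apply/negP => /andP[/imsetP[u ui ->]].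
    by apply/negP; apply: H; rewrite mem_filter mem_enum andbT; rewrite inE in ui.
  apply: le_trans (avoid_sum _ _) _; first by rewrite filter_uniq ?enum_uniq.
  rewrite sP ler_pM2l ?ltr0n ?fact_gt0 //.
  set x := (_ / _)%R.
  have nR : (0 < n%:R :> R)%R by rewrite ltr0n.
  have x01 : (0 <= x <= 1)%R.
    by rewrite /x divr_ge0 ?ler0n //= ler_pdivrMr // mul1r ler_nat.
  (* Here 2240 = 7 * 4 * 80. *)
  have Lx : (7 <= L%:R * x)%R.
    rewrite /x mulrA ler_pdivlMr // -!natrM ler_nat; nia.
  have := bernoulli_le L x01; have : (0 <= (1 - x) ^+ L)%R by apply: exprn_ge0; lra.
  by nra.
have tot : (\sum_(s : 'S_n) (miss s)%:R <= (80 * p)%:R * (n`!%:R / 8) :> R)%R.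
  rewrite (eq_bigr (fun s => \sum_(i < 80 * p) [disjoint block s L (i * L) & T]%:R)%R); last first.
    move=> s _; rewrite -natr_sum; congr (_%:R)%R.
    by rewrite /miss -sum1_card big_mkcond; apply: eq_bigr => i _; rewrite inE; case: ifP.
  rewrite exchange_big /= -[X in (X%:R * _)%R]card_ord mulr_natl -sumr_const.
  by apply: ler_sum => i _; apply: one.
have sV : (\sum_(s : 'S_n) (~~ V s)%:R + \sum_(s : 'S_n) (V s)%:R = n`!%:R :> R)%R.
  rewrite -big_split /= (eq_bigr (fun=> 1%R)); first by rewrite sumr_const card_Sn.
  by move=> s _; case: (V s); rewrite ?addr0 ?add0r.
have : ((20 * p)%:R * \sum_(s : 'S_n) (~~ V s)%:R <= (80 * p)%:R * (n`!%:R / 8) :> R)%R.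
  by apply: le_trans tot; rewrite mulr_sumr; apply: ler_sum => s _; apply: nV.
have pR : (0 < p%:R :> R)%R by rewrite ltr0n.
have -> : ((80 * p)%:R * (n`!%:R / 8) = (20 * p)%:R * (n`!%:R / 2) :> R)%R.
  by rewrite !natrM; field.
rewrite ler_pM2l; last by rewrite ltr0n; lia.
by move: sV; set a := (\sum_(s : 'S_n) _)%R; set b := (\sum_(s : 'S_n) _)%R; lra.
Qed.

End SampleValid.

(** * The algorithm *)

Section Run.
Variable n : nat.
Implicit Types (G : {set {set 'I_n}}) (p k m : nat) (W S : {set 'I_n}) (t u : 'I_n).

Definition block_length p := n./2 %/ (80 * p).

(** Items are named by arrival time here, so the order is the identity. *)
Definition sample_valid G p : bool :=
  rainbow_ext G (blocks_from 1%g (block_length p) (80 * p) 0) set0 (60 * p).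

(* The value is 0 when no p fits, which selects the fallback in [take_test]. *)
Definition guess G : nat := \max_(p < n.+1 | (4 <= p) && sample_valid G p) p.

Definition block_index p t := (t - n./2) %/ block_length p.

Definition block_test G p W t : bool :=
  [&& block_index p t < 20 * p,
      [forall u in W, block_index p u != block_index p t]
    & rainbow_ext G (blocks_from 1%g (block_length p) (80 * p) (block_index p t).+1)
        (t |: W) (60 * p - (block_index p t).+1)].

Definition take_test G p W t : bool :=
  [&& n./2 <= t, t |: W \in G & if p == 0 then W == set0 else block_test G p W t].

Fixpoint run G p k : {set 'I_n} :=
  if k is k'.+1 then
    let W := run G p k' in
    if insub k' is Some t then if take_test G p W t then t |: W else W else W
  else set0.

Lemma runS G p t :
  run G p t.+1 = if take_test G p (run G p t) t then t |: run G p t else run G p t.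
Proof. by rewrite /= valK. Qed.

Lemma run_range G p k u : u \in run G p k -> n./2 <= u < k.
Proof.
elim: k => [|k IH] /=; first by rewrite inE.
case: insubP => [t _ tk|_ /IH /andP[-> /ltnW]//].
case: ifP => [/and3P[ht _ _]|_ /IH /andP[-> /ltnW]//].
rewrite inE => /orP[/set1P ->|/IH /andP[-> /ltnW]//].
by rewrite tk in ht *; rewrite ht /=.
Qed.

Lemma run_feasible G p k : set0 \in G -> run G p k \in G.
Proof.
move=> G0; elim: k => [|k IH] //=.
by case: insubP => // t _ _; case: ifP => // /and3P[].
Qed.

Lemma run_mono G p k m : k <= m -> run G p k \subset run G p m.
Proof.
elim: m => [|m IH]; first by rewrite leqn0 => /eqP ->.
rewrite leq_eqVlt => /orP[/eqP ->//|km].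
apply: subset_trans (IH km) _ => /=.
by case: insubP => // t _ _; case: ifP => // _; apply: subsetUr.
Qed.

(** This expresses that the algorithm is online: observation fixes the family only on sets of items
    that have arrived, and the decisions so far must depend on nothing else. *)
Definition agree_upto m G G' := forall S,
  (forall u, u \in S -> u < m) -> (S \in G) = (S \in G').

Lemma rainbow_ext_agree m G G' L (K b : nat) W q :
  agree_upto m G G' -> K * L <= m -> (forall u, u \in W -> u < m) ->
  rainbow_ext G (blocks_from 1%g L K b) W q = rainbow_ext G' (blocks_from 1%g L K b) W q.
Proof.
move=> ag KL Wm; apply/rainbow_extP/rainbow_extP => -[Z [qZ ZC Z1 ZF]];
  exists Z; split=> //; move: ZF; rewrite ag // => u;
  rewrite inE => /orP[/(subsetP ZC)/bigcupP[D /blocks_fromP[i /andP[_ iK] ->]]|/Wm//];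
  move=> /imsetP[v]; rewrite inE perm1 => vi ->; nia.
Qed.

Lemma block_length_half p : 80 * p * block_length p <= n./2.
Proof. by rewrite mulnC leq_trunc_div. Qed.

Lemma sample_valid_agree m G G' p : n./2 <= m -> agree_upto m G G' ->
  sample_valid G p = sample_valid G' p.
Proof.
move=> hm ag; apply: rainbow_ext_agree ag _ _; last by move=> u; rewrite inE.
exact: leq_trans (block_length_half p) hm.
Qed.

(** The guess reads only sample blocks, which lie in the first half, so it is fixed before anything
    is accepted. *)
Lemma guess_agree m G G' : n./2 <= m -> agree_upto m G G' -> guess G = guess G'.
Proof.
by move=> hm ag; apply: eq_bigl => p; rewrite (sample_valid_agree _ hm ag).
Qed.

Lemma take_test_agree m G G' p W t : agree_upto m G G' ->
  (forall u, u \in W -> u < m) -> t < m -> take_test G p W t = take_test G' p W t.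
Proof.
move=> ag Wm tm; rewrite /take_test; case: leqP => //= ht.
have tW u : u \in t |: W -> u < m by rewrite inE => /orP[/set1P ->|/Wm].
rewrite ag //; congr (_ && _); case: ifP => // _.
rewrite /block_test (rainbow_ext_agree _ _ ag) //.
by apply: leq_trans (block_length_half p) _; apply: leq_trans ht (ltnW tm).
Qed.

Lemma run_agree m G G' p k : agree_upto m G G' -> k <= m -> run G p k = run G' p k.
Proof.
move=> ag; elim: k => [|k IH] //= km.
rewrite IH ?(ltnW km) //; case: insubP => // t _ tk.
rewrite (take_test_agree _ ag) //; last by rewrite tk.
by move=> u /run_range /andP[_ uk]; apply: ltn_trans uk km.
Qed.

Lemma run_fallback G t : n./2 <= t -> [set t] \in G -> 0 < #|run G 0 n|.
Proof.
move=> ht tG; rewrite card_gt0.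
have [e|ne] := eqVneq (run G 0 t) set0.
  have : t \in run G 0 n; last by move=> tr; apply/set0Pn; exists t.
  apply: (subsetP (run_mono G 0 (ltn_ord t))).
  by rewrite runS /take_test ht e setU0 tG !eqxx /= !inE eqxx.
apply: contra_neq ne => e; apply/eqP; rewrite -subset0 -e.
by apply: run_mono; apply: ltnW.
Qed.

Lemma guessP G p : 4 <= p -> sample_valid G p -> p < n.+1 ->
  [/\ p <= guess G, 4 <= guess G, guess G < n.+1 & sample_valid G (guess G)].
Proof.
move=> p4 pv pn.
have pg : p <= guess G.
  by apply: (@leq_bigmax_cond _ _ (fun i : 'I_n.+1 => i : nat) (Ordinal pn)); rewrite p4.
have [|q /andP[q4 qv] e] := @eq_bigmax_cond _
  [pred q : 'I_n.+1 | (4 <= q) && sample_valid G q] (fun i : 'I_n.+1 => i : nat).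
  by apply/card_gt0P; exists (Ordinal pn); rewrite inE p4.
by rewrite /guess e q4 qv ltn_ord; split=> //; rewrite -e.
Qed.

Lemma guess_cases G : guess G = 0 \/
  [/\ 4 <= guess G, guess G < n.+1 & sample_valid G (guess G)].
Proof.
case: (pickP [pred q : 'I_n.+1 | (4 <= q) && sample_valid G q]) => [q /andP[q4 qv]|none].
  by right; have [] := guessP q4 qv (ltn_ord q).
by left; rewrite /guess big_pred0.
Qed.

End Run.

(** * Transport between items and arrival times *)

Section Pull.
Variables (n : nat) (F : {set {set 'I_n}}).
Hypothesis Fdc : downward_closed F.
Implicit Types (s : 'S_n).

Definition pull s : {set {set 'I_n}} := [set S : {set 'I_n} | s @: S \in F].

Lemma pull_dc s : downward_closed (pull s).
Proof.
split=> [|S S' SS]; first by rewrite inE imset0; exact: Fdc.1.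
by rewrite !inE; apply: Fdc.2; apply: imsetS.
Qed.

Lemma blockE s L a : block s L a = s @: block 1%g L a.
Proof.
by rewrite /block -imset_comp; apply: eq_imset => u /=; rewrite perm1.
Qed.

Lemma card_imset_perm s (A : {set 'I_n}) : #|s @: A| = #|A|.
Proof. by apply: card_imset; apply: perm_inj. Qed.

Lemma imset_permI s (A B : {set 'I_n}) : s @: (A :&: B) = s @: A :&: s @: B.
Proof. by apply: imsetI => ? ? _ _; apply: perm_inj. Qed.

Lemma rainbow_ext_pull s L (K b : nat) W q :
  rainbow_ext (pull s) (blocks_from 1%g L K b) W q
  = rainbow_ext F (blocks_from s L K b) (s @: W) q.
Proof.
apply/rainbow_extP/rainbow_extP => -[Z [qZ ZC Z1 ZF]].
  exists (s @: Z); split; first by rewrite card_imset_perm.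
  - apply/subsetP => x /imsetP[u uZ ->].
    have /bigcupP[D /blocks_fromP[i /andP[bi iK] ->] uD] := subsetP ZC _ uZ.
    apply/bigcupP; exists (block s L (i * L)); first exact: mem_blocks_from.
    by rewrite blockE imset_f.
  - move=> D /blocks_fromP[i /andP[bi iK] ->].
    by rewrite blockE -imset_permI card_imset_perm; apply: Z1; apply: mem_blocks_from.
  - by move: ZF; rewrite inE imsetU.
have EZ : Z = s @: (s @^-1: Z).
  apply/setP => x; apply/idP/imsetP => [xZ|[u]]; last by rewrite inE => ? ->.
  by exists (s^-1 x)%g; rewrite ?inE permKV.
rewrite EZ in qZ ZC Z1 ZF; set Y := s @^-1: Z in qZ ZC Z1 ZF.
exists Y; split; first by rewrite card_imset_perm in qZ.
- apply/subsetP => u uY.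
  have /bigcupP[D /blocks_fromP[i /andP[bi iK] ->]] := subsetP ZC _ (imset_f s uY).
  rewrite blockE (mem_imset _ _ (@perm_inj _ s)) => ui.
  by apply/bigcupP; exists (block 1%g L (i * L)) => //; apply: mem_blocks_from.
- move=> D /blocks_fromP[i /andP[bi iK] ->].
  rewrite -(card_imset_perm s) imset_permI -blockE.
  by apply: Z1; apply: mem_blocks_from.
- by rewrite inE imsetU.
Qed.

End Pull.

(** * Every run on a valid sample follows some schedule *)

Section RunFollows.
Variables (n : nat) (F : {set {set 'I_n}}).
Hypothesis Fdc : downward_closed F.
Variables (s : 'S_n) (p : nat).
Let G := pull F s.
Let Gdc : downward_closed G := pull_dc Fdc s.
Let h := n./2.
Let L := block_length n p.
Hypothesis p0 : 0 < p.
Hypothesis valid : sample_valid G p.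

Let W b := run G p (h + b * L).
Let ext b A := rainbow_ext G (blocks_from 1%g L (80 * p) b.+1) A (60 * p - b.+1).

Let KL : 80 * p * L <= h.
Proof. exact: block_length_half. Qed.

Let hn : h + h <= n.
Proof. by rewrite addnn -[X in _ <= X]odd_double_half leq_addl. Qed.

Let L0 : 0 < L.
Proof.
rewrite lt0n; apply/negP => /eqP Le; move/rainbow_extP: valid => [Z [qZ ZC _ _]].
rewrite -/L Le in ZC.
have Z0 : Z \subset set0.
  apply: subset_trans ZC _; apply/subsetP => x /bigcupP[D /blocks_fromP[i _ ->]].
  by move=> /imsetP[u]; rewrite inE; lia.
by move: qZ; rewrite subset0 in Z0; rewrite (eqP Z0) cards0; lia.
Qed.

(** Induction on the arrivals within a block. Until the first acceptance every item is tested
    against [W b]; afterwards the clause on block indices rejects the rest of the block. *)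
Lemma run_block_partial b j : b < 20 * p -> j <= L ->
  (run G p (h + b * L + j) = W b /\
    forall u : 'I_n, h + b * L <= u < h + b * L + j -> ~~ ext b (u |: W b)) \/
  exists u : 'I_n, [/\ h + b * L <= u < h + b * L + j,
    run G p (h + b * L + j) = u |: W b & ext b (u |: W b)].
Proof.
move=> bp; elim: j => [|j IH] jL.
  by left; rewrite addn0; split=> // u; lia.
have tn : h + b * L + j < n by nia.
pose t := Ordinal tn.
have bt : block_index p t = b.
  by rewrite /block_index /= -addnA addKn -/L divnMDl // divn_small ?addn0.
have tS : h + b * L + j.+1 = t.+1 by rewrite addnS.
rewrite tS runS; case: (IH (ltnW jL)) => [[e rej]|[u [ub e eu]]].
  rewrite e; have -> : take_test G p (W b) t = ext b (t |: W b).
    rewrite /take_test /block_test bt (negbTE (lt0n_neq0 p0)) bp /=.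
    have -> : n./2 <= h + b * L + j by rewrite -addnA leq_addr.
    have -> /= : [forall u in W b, block_index p u != b].
      apply/forall_inP => u /run_range /andP[hu ub].
      rewrite neq_ltn /block_index ltn_divLR -/L // ; apply/orP; left.
      by rewrite -/h; lia.
    rewrite -/L -/(ext b (t |: W b)); case ex: (ext _ _); rewrite ?andbF //.
    by rewrite andbT (rainbow_ext_feasible Gdc ex).
  case: ifP => ex.
    by right; exists t; split=> //=; lia.
  left; split=> // u /andP[u1 u2].
  have [ut|ut] := eqVneq (u : nat) (t : nat).
    by rewrite (val_inj ut : u = t) ex.
  by apply: rej; rewrite u1 /=; move: u2 ut => /=; lia.
right; exists u; split=> //; first by move: ub; rewrite /=; lia.
rewrite e ifF //; apply/negP => /and3P[_ _].
rewrite (negbTE (lt0n_neq0 p0)) => /and3P[_ /forall_inP/(_ u) + _].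
rewrite !inE eqxx bt /block_index -/L => /(_ isT) /eqP []; rewrite -/h.
have -> : u - h = b * L + (u - h - b * L) by lia.
by rewrite divnMDl // divn_small ?addn0 //; lia.
Qed.

Lemma run_block b : b < 20 * p -> exists o : option 'I_n,
  if o is Some u then
    [/\ h + b * L <= u < h + b * L + L, W b.+1 = u |: W b & ext b (u |: W b)]
  else W b.+1 = W b /\
    forall u : 'I_n, h + b * L <= u < h + b * L + L -> ~~ ext b (u |: W b).
Proof.
move=> bp; have E : h + b.+1 * L = h + b * L + L by rewrite mulSn; lia.
rewrite /W E; case: (run_block_partial bp (leqnn L)) => [H|[u H]].
  by exists None.
by exists (Some u).
Qed.

Lemma prior_succ (w : nat -> option 'I_n) b :
  prior w b.+1 = if w b is Some x then x |: prior w b else prior w b.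
Proof.
apply/setP => x; rewrite inE; apply/existsP/idP => [[i /eqP wi]|].
  case: (ltngtP i b) => [ib|ib|ib]; last by rewrite -ib wi setU11.
  - have : x \in prior w b by rewrite inE; apply/existsP; exists (Ordinal ib); rewrite wi.
    by case: (w b) => // y xp; rewrite setU1r.
  - by have := ltn_ord i; lia.
have old : x \in prior w b -> exists i : 'I_b.+1, w i == Some x.
  by rewrite inE => /existsP[i wi]; exists (widen_ord (leqnSn b) i).
case e: (w b) => [y|//]; rewrite in_setU1 => /orP[/eqP ->|//].
by exists ord_max; rewrite /= e.
Qed.

(** The schedule is read off the run. The invariant at the next block is the passed test itself
    after an acceptance, and otherwise comes from dropping block [b]. *)
Lemma run_follows : exists f : {ffun 'I_(20 * p) -> option 'I_n},
  (\sum_i (f i : bool) <= #|run G p n|)%N && follows F p L h (schedule_at f) s.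
Proof.
have [o ho] := fin_all_exists (fun i : 'I_(20 * p) => run_block (ltn_ord i)).
pose f := [ffun i => omap s (o i)].
have fE (i : 'I_(20 * p)) : schedule_at f i = omap s (o i).
  by rewrite /schedule_at valK ffunE.
have W0 : W 0 = set0.
  by apply/setP => u; rewrite inE; apply/negP => /run_range; rewrite -/h; lia.
have priorE b : b <= 20 * p -> prior (schedule_at f) b = s @: W b.
  elim: b => [|b IH] bp.
    rewrite W0 imset0; apply/setP => x; rewrite in_set0 inE; apply/existsP => -[i].
    by have := ltn_ord i.
  rewrite prior_succ IH ?(ltnW bp) // -[b]/(val (Ordinal bp)) fE.
  have := ho (Ordinal bp); case: (o _) => [u [_ -> _]|[-> _]] //=.
  by rewrite imsetU1.
have inv b : b <= 20 * p -> slack_inv F p L (schedule_at f) s b.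
  elim: b => [|b IH] bp.
    rewrite /slack_inv priorE // W0 -rainbow_ext_pull subn0; exact: valid.
  have := IH (ltnW bp); rewrite /slack_inv !priorE ?(ltnW bp) // -!rainbow_ext_pull.
  have := ho (Ordinal bp); case: (o _) => [u [_ /= -> eu] _|[/= -> _] iv]; first exact: eu.
  apply: (@rainbow_ext_drop _ _ Gdc (blocks_from 1%g L (80 * p) b) _ (block 1%g L (b * L))).
  - apply/subsetP => D /blocks_fromP[i /andP[bi iK] ->]; rewrite inE.
    have [<-|bi'] := eqVneq b i; first by rewrite inE eqxx.
    by rewrite mem_blocks_from ?orbT //; lia.
  - exact: blocks_from_sub.
  - by apply: mem_blocks_from => //; lia.
  - by move: iv; congr (rainbow_ext _ _ _ _); lia.
exists f; apply/andP; split.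
  apply: leq_trans (_ : #|W (20 * p)| <= _); last first.
    by apply: subset_leq_card; apply: run_mono; nia.
  have -> : \sum_i (f i : bool) = \sum_(i < 20 * p) (schedule_at f i : bool).
    by apply: eq_bigr => i _; rewrite fE ffunE.
  have : forall b, b <= 20 * p -> \sum_(i < b) (schedule_at f i : bool) <= #|W b|.
    elim=> [|b IH] bp; first by rewrite big_ord0.
    rewrite big_ord_recr /=; have := IH (ltnW bp).
    rewrite -[X in schedule_at f X]/(val (Ordinal bp)) fE.
    have := ho (Ordinal bp); case: (o _) => [u [/= ub -> _]|[/= -> _]] /=.
      rewrite cardsU1; have -> : u \notin W b by apply/negP => /run_range; lia.
      by rewrite addn1 add1n ltnS.
    by rewrite addn0.
  exact.
apply/forallP => i; rewrite inv ?(ltnW (ltn_ord i)) //= fE.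
have := ho i; case: (o i) => [//|[_ rej]] /=.
rewrite /good_block priorE ?(ltnW (ltn_ord i)) //; apply/exists_inP => -[x].
move=> /imsetP[u]; rewrite inE => ub -> ex.
move/negP: (rej _ ub); apply; rewrite /ext rainbow_ext_pull imsetU1.
exact: ex.
Qed.

End RunFollows.

(** Sets containing an item of value other than 1 count as infeasible, so such items are never taken
    and cardinality measures value. *)
Definition observed_ones (R : realType) (n : nat) (t : 'I_n)
    (v : {ffun 'I_t.+1 -> R}) (O : {set {set 'I_t.+1}}) : {set {set 'I_n}} :=
  [set S : {set 'I_n} | [exists S0 : {set 'I_t.+1},
    [&& S0 \in O, [forall j in S0, v j == 1%R] & S == widen_ord (ltn_ord t) @: S0]]].

(** The earlier decisions are recomputed by replaying the run on the current observations. *)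
Definition block_algorithm (R : realType) : online_algorithm R :=
  fun n t v O => let G := observed_ones v O in
    take_test G (guess G) (run G (guess G) t) t.
Arguments block_algorithm R n t v O : clear implicits.

(** * Competitive analysis *)

Section Performance.
Variables (R : realType) (n : nat) (I : instance R n).
Hypothesis Ibin : binary I.
Implicit Types (s : 'S_n) (t u : 'I_n) (p k : nat).

Definition feasible_ones : {set {set 'I_n}} :=
  [set S in feasible I | [forall i in S, value I i == 1%R]].

Lemma feasible_ones_dc : downward_closed feasible_ones.
Proof.
have [F0 Fsub] := feasible_dc I; split=> [|S S' SS].
  by rewrite inE F0; apply/forall_inP => i; rewrite inE.
rewrite !inE => /andP[S'F /forall_inP H]; rewrite (Fsub _ _ SS S'F).
by apply/forall_inP => i /(subsetP SS)/H.
Qed.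

Let F := feasible_ones.
Let Fdc := feasible_ones_dc.

Lemma observed_ones_agree s t : agree_upto t.+1
  (observed_ones (observed_values I s t) (observed_feasible I s t)) (pull F s).
Proof.
move=> S St; have E (S0 : {set 'I_t.+1}) :
    [set arrived s j | j in S0] = s @: (widen_ord (ltn_ord t) @: S0).
  by rewrite -imset_comp.
apply/idP/idP; rewrite !inE.
  move=> /existsP[S0 /and3P[+ /forall_inP v1 /eqP ->]]; rewrite inE E => -> /=.
  apply/forall_inP => x /imsetP[_ /imsetP[j jS ->] ->].
  by have := v1 _ jS; rewrite ffunE.
move=> /andP[SF /forall_inP v1]; apply/existsP.
have ES : S = widen_ord (ltn_ord t) @: (widen_ord (ltn_ord t) @^-1: S).
  apply/setP => u; apply/idP/imsetP => [uS|[j]]; last by rewrite inE => ? ->.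
  have e : widen_ord (ltn_ord t) (Ordinal (St _ uS)) = u by apply: val_inj.
  by exists (Ordinal (St _ uS)); rewrite ?inE e.
exists (widen_ord (ltn_ord t) @^-1: S); rewrite inE E -ES SF eqxx andbT /=.
by apply/forall_inP => j; rewrite inE ffunE => jS; apply: v1; apply: imset_f.
Qed.

Let G s := pull F s.

Lemma accepts_block_algorithm s t : accepts (block_algorithm R) I s t =
  take_test (G s) (guess (G s)) (run (G s) (guess (G s)) t) t.
Proof.
have ag := @observed_ones_agree s t; rewrite /accepts /block_algorithm.
(* In the first half the guess may still change, but nothing is taken. *)
set G' := observed_ones _ _ in ag *; case: (leqP n./2 t) => ht; last first.
  by rewrite /take_test leqNgt ht.
have hm : n./2 <= t.+1 by apply: leqW.
rewrite (guess_agree hm ag) (run_agree _ ag) //.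
by apply: take_test_agree ag _ _ => // u /run_range /andP[_ /ltnW].
Qed.

Lemma selected_block_algorithm s k : k <= n ->
  selected (block_algorithm R) I s k = s @: run (G s) (guess (G s)) k.
Proof.
rewrite /selected; elim: k => [|k IH] kn.
  by rewrite imset0; apply/setP => x; rewrite in_set0.
pose t := Ordinal kn.
rewrite (runS (G s) (guess (G s)) t : run _ _ k.+1 = _) -accepts_block_algorithm.
have H : s @: run (G s) (guess (G s)) k =
    [set s t | t : 'I_n & (t < k) && accepts (block_algorithm R) I s t].
  by rewrite -IH // ltnW.
have -> : [set s t | t : 'I_n & (t < k.+1) && accepts (block_algorithm R) I s t] =
    if accepts (block_algorithm R) I s t then s t |: s @: run (G s) (guess (G s)) k
    else s @: run (G s) (guess (G s)) k.
  rewrite H; apply/setP => x; apply/imsetP/idP => [[u]|].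
    rewrite !inE ltnS leq_eqVlt => /andP[/orP[/eqP ut|uk] au] ->.
      by have <- : u = t by [apply: val_inj]; rewrite au setU11.
    have ux : s u \in [set s t | t : 'I_n & (t < k) && accepts (block_algorithm R) I s t].
      by apply: imset_f; rewrite inE uk.
    by case: ifP => // _; rewrite setU1r.
  have old : x \in [set s t | t : 'I_n & (t < k) && accepts (block_algorithm R) I s t] ->
      exists2 u, u \in [set u : 'I_n | (u < k.+1) && accepts (block_algorithm R) I s u] & x = s u.
    move=> /imsetP[u]; rewrite inE => /andP[uk au] ->.
    by exists u; rewrite // inE au ltnS (ltnW uk).
  case: ifP => [at_|_]; last by move=> /old.
  by rewrite in_setU1 => /orP[/eqP ->|/old//]; exists t; rewrite // inE at_ /= leqnn.
by case: ifP => // _; rewrite imsetU1.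
Qed.

Lemma block_algorithm_feasible : keeps_feasible (block_algorithm R) I.
Proof.
move=> s k kn; rewrite selected_block_algorithm //.
have : run (G s) (guess (G s)) k \in G s by apply: run_feasible; exact: (pull_dc Fdc s).1.
by rewrite !inE => /andP[].
Qed.

Definition gain s : nat := #|run (G s) (guess (G s)) n|.

Lemma alg_value_gain s : alg_value (block_algorithm R) I s = (gain s)%:R%R.
Proof.
rewrite /alg_value selected_block_algorithm //.
have : run (G s) (guess (G s)) n \in G s by apply: run_feasible; exact: (pull_dc Fdc s).1.
rewrite !inE => /andP[_ /forall_inP H].
rewrite (eq_bigr (fun=> 1%R)) => [|i /H/eqP//].
by rewrite sumr_const card_imset_perm.
Qed.

Lemma opt_value_feasible_ones : exists2 T, T \in F & (opt_value I <= #|T|%:R)%R.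
Proof.
have [|T TF Tmax] := @eq_bigmax_cond _ (mem F) (fun S : {set 'I_n} => #|S|).
  by apply/card_gt0P; exists set0; exact: Fdc.1.
exists T => //; apply: bigmax_le => [|S SF]; first exact: ler0n.
pose S1 := [set i in S | value I i == 1%R].
have -> : (\sum_(i in S) value I i = #|S1|%:R)%R.
  rewrite -sum1_card natr_sum big_mkcond [RHS]big_mkcond /=.
  apply: eq_bigr => i _; rewrite inE; case: (i \in S) => //=.
  by case: (Ibin i) => ->; rewrite ?eqxx // eq_sym oner_eq0.
rewrite ler_nat -Tmax; apply: (@leq_bigmax_cond _ (mem F) (fun S : {set 'I_n} => #|S|)).
rewrite inE /= inE; apply/andP; split.
  by apply: (feasible_dc I).2 _ _ _ SF; apply/subsetP => i; rewrite inE => /andP[].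
by apply/forall_inP => i; rewrite inE => /andP[].
Qed.

Variable l : nat.
Hypothesis n0 : 0 < n.
Hypothesis l0 : 0 < l.
Hypothesis nl : n <= 2 ^ l.

Definition fails s p : bool :=
  sample_valid (G s) p && (#|run (G s) p n| <= p %/ (6 * l)).

(** Since 32 n <= 2^(6l) and k <= p / (6l), the factor (32 n)^k is at most 2^p, and 4^-p absorbs
    it. *)
Lemma fails_sum p : 0 < p ->
  (\sum_(s : 'S_n) (fails s p)%:R <= n`!%:R * 2 * 2^-1 ^+ p :> R)%R.
Proof.
move=> p0; set k := p %/ (6 * l).
have hn : n./2 + n./2 <= n by rewrite addnn -[X in _ <= X]odd_double_half leq_addl.
apply: le_trans (_ : _ <= n`!%:R * 4^-1 ^+ p * 2 * (32 * n%:R) ^+ k)%R _.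
  apply: le_trans (few_acceptances R Fdc (block_length_half n p) hn n0 k).
  apply: ler_sum => s _; rewrite ler_nat; case fs: (fails s p) => //.
  rewrite lt0b; move: fs => /andP[v few].
  have [f /andP[fk ff]] := run_follows Fdc p0 v.
  by apply/existsP; exists f; rewrite ff (leq_trans fk few).
have nR : (32 * n%:R <= 2 ^+ (6 * l) :> R)%R.
  rewrite -natrM -natrX ler_nat; apply: leq_trans (_ : 2 ^ 5 * 2 ^ l <= _).
    by rewrite leq_mul2l nl orbT.
  by rewrite -expnD leq_exp2l //; lia.
have kp : ((32 * n%:R) ^+ k <= 2 ^+ p :> R)%R.
  apply: le_trans (_ : _ <= (2 ^+ (6 * l)) ^+ k)%R _.
    by apply: lerXn2r; rewrite ?nnegrE ?exprn_ge0 ?mulr_ge0.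
  by rewrite -exprM ler_eXn2l ?ltr1n // mulnC leq_trunc_div.
have -> : (n`!%:R * 2 * 2^-1 ^+ p = n`!%:R * 4^-1 ^+ p * 2 * 2 ^+ p :> R)%R.
  have -> : (2^-1 = 4^-1 * 2 :> R)%R by lra.
  by rewrite exprMn; ring.
apply: ler_wpM2l kp.
by rewrite !mulr_ge0 ?exprn_ge0 ?invr_ge0 ?ler0n.
Qed.

Definition bad s : bool := [exists p : 'I_n.+1, (4 <= p) && fails s p].

(** The guess depends on the order, so all p are excluded at once. Starting at p = 4 makes the
    geometric series 2 * 1/8. *)
Lemma bad_sum : (\sum_(s : 'S_n) (bad s)%:R <= n`!%:R / 4 :> R)%R.
Proof.
apply: le_trans (_ : _ <= \sum_(s : 'S_n) \sum_(p < n.+1 | (4 <= p)%N) (fails s p)%:R)%R _.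
  apply: ler_sum => s _; rewrite /bad; case: existsP => [[p /andP[p4 fp]]|_]; last first.
    by apply: sumr_ge0 => p _; exact: ler0n.
  by rewrite (bigD1 p) //= fp ler_wpDr // sumr_ge0 // => q _; exact: ler0n.
rewrite exchange_big /=.
apply: le_trans (_ : _ <= \sum_(p < n.+1 | (4 <= p)%N) n`!%:R * 2 * 2^-1 ^+ p)%R _.
  by apply: ler_sum => p p4; apply: fails_sum; apply: leq_trans p4.
rewrite -mulr_sumr -mulrA ler_pM2l ?ltr0n ?fact_gt0 //.
have geo N : (\sum_(p < N | (4 <= p)%N) 2^-1 ^+ p <= 8^-1 :> R)%R.
  suff H d : (\sum_(p < d + 4 | (4 <= p)%N) 2^-1 ^+ p <= 8^-1 * (1 - 2^-1 ^+ d) :> R)%R.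
    apply: le_trans (_ : _ <= \sum_(p < N + 4 | (4 <= p)%N) 2^-1 ^+ p)%R _.
      rewrite -!(big_mkord (fun p => 4 <= p) (fun p => 2^-1 ^+ p : R)%R).
      by rewrite [leRHS](big_cat_nat (n := N)) ?leq_addr //= lerDl sumr_ge0.
    apply: le_trans (H N) _.
    have : (0 <= 2^-1 ^+ N :> R)%R by rewrite exprn_ge0 ?invr_ge0.
    lra.
  elim: d => [|d IH].
    by rewrite big_pred0 ?expr0 ?subrr ?mulr0 // => i; rewrite leqNgt ltn_ord.
  rewrite addSn big_mkcond big_ord_recr /= -big_mkcond /= leq_addl.
  apply: le_trans (lerD IH (lexx _)) _.
  by rewrite exprD exprS !exprSr expr0; set x := (_ ^+ d)%R; lra.
by apply: le_trans (_ : 2 * 8^-1 <= _)%R; [rewrite ler_pM2l|lra].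
Qed.

Lemma gain_large s p : ~~ bad s -> 4 <= p -> sample_valid (G s) p -> p < n.+1 ->
  p <= gain s * (6 * l).
Proof.
move=> nb p4 pv pn; have [pg g4 gn gv] := guessP p4 pv pn.
have : ~~ fails s (guess (G s)).
  by apply: contra nb => fg; apply/existsP; exists (Ordinal gn); rewrite /= g4.
rewrite /fails gv -ltnNge -/(gain s) ltn_divLR; last by lia.
by move=> /ltnW; apply: leq_trans.
Qed.

Lemma gain_pos s t : ~~ bad s -> n./2 <= t -> [set s t] \in F -> 0 < gain s.
Proof.
move=> nb ht tF; rewrite /gain; case: (guess_cases (G s)) => [->|[g4 gn gv]].
  by apply: run_fallback ht _; rewrite inE imset_set1.
have := gain_large nb g4 gv gn; rewrite -/(gain s); case: (gain s) => //.
by rewrite mul0n; lia.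
Qed.

(** Exchanging the two halves pairs the orders so that [x] is late in at least one of each pair. For
    odd n the last position is fixed and already late. *)
Lemma late_sum (x : 'I_n) :
  (n`!%:R / 2 <= \sum_(s : 'S_n) [exists t : 'I_n, (n./2 <= t)%N && (s t == x)]%:R :> R)%R.
Proof.
pose f (s : 'S_n) : R := [exists t : 'I_n, (n./2 <= t)%N && (s t == x)]%:R%R.
rewrite -[leRHS]/(\sum_(s : 'S_n) f s)%R.
pose h := n./2; pose tau := block_swap n h 0 h.
have hn : h + h <= n by rewrite addnn -[X in _ <= X]odd_double_half leq_addl.
have one s : (1 <= f s + f (tau * s)%g)%R.
  have [/existsP fs|/existsP fs] := boolP [exists t : 'I_n, (n./2 <= t)%N && (s t == x)].
    by rewrite {1}/f (introT existsP fs) lerDl ler0n.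
  have xb : x \in block s h 0.
    apply/imsetP; exists (s^-1 x)%g; last by rewrite permKV.
    rewrite inE /= add0n ltnNge; apply/negP => hx; apply: fs; exists (s^-1 x)%g.
    by rewrite hx permKV eqxx.
  have hh : h <= n by lia.
  have ap : apart h 0 h by rewrite /apart add0n leqnn orbT.
  move: xb; rewrite -(block_swapR s ap _ hn) ?add0n // => /imsetP[u].
  rewrite inE => /andP[hu _] xe.
  rewrite [X in (_ + X)%R]/f (_ : [exists t : 'I_n, _] = true) ?lerDr ?ler0n //.
  by apply/existsP; exists u; rewrite hu xe eqxx.
have : (n`!%:R <= \sum_s f s + \sum_s f s)%R.
  rewrite [X in (_ + X)%R](reindex_inj (mulgI tau)) -big_split /=.
  have -> : (n`!%:R = \sum_(s : 'S_n) 1 :> R)%R by rewrite sumr_const card_Sn.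
  by apply: ler_sum => s _; apply: one.
by set S := (\sum_s _)%R; lra.
Qed.

(** A large [T] makes the sample valid for p = #|T| / 2240 with probability at least 1/2. For a
    small nonempty [T], a late arrival of one of its items suffices. *)
Lemma gain_sum T : T \in F ->
  (#|T|%:R * n`!%:R <= 2 ^+ 18 * l%:R * \sum_(s : 'S_n) (gain s)%:R :> R)%R.
Proof.
move=> TF; set S := (\sum_s _)%R; have fn : (0 < n`!%:R :> R)%R by rewrite ltr0n fact_gt0.
have bs := bad_sum.
have Tn : #|T| <= n by rewrite -[X in _ <= X]card_ord; apply: max_card.
have l1 : (1 <= l%:R :> R)%R by rewrite ler1n.
have S0 : (0 <= S)%R by apply: sumr_ge0 => s _; exact: ler0n.
(* An event of probability at least 1/2 keeps at least 1/4 outside [bad]. *)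
have diff (f : 'S_n -> bool) (c : R) : (0 <= c)%R ->
    (n`!%:R / 2 <= \sum_(s : 'S_n) (f s)%:R :> R)%R ->
    (forall s, f s -> ~~ bad s -> (1 <= c * (gain s)%:R)%R) -> (n`!%:R <= 4 * (c * S))%R.
  move=> c0 fs fb.
  have : (\sum_(s : 'S_n) (f s)%:R <= c * S + \sum_(s : 'S_n) (bad s)%:R :> R)%R.
    rewrite mulr_sumr -big_split /=; apply: ler_sum => s _.
    have g0 : (0 <= c * (gain s)%:R)%R by rewrite mulr_ge0.
    have := fb s; case: (f s); case: (bad s) => /=; rewrite ?addr0 => H; lra.
  lra.
case: (leqP (2240 * 4) #|T|) => kT.
  pose p := #|T| %/ 2240.
  have p4 : 4 <= p by rewrite leq_divRL // mulnC.
  have pT : 2240 * p <= #|T| by rewrite mulnC leq_trunc_div.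
  have Tp : #|T| <= 2 ^ 13 * p.
    have := divn_eq #|T| 2240; have := ltn_pmod #|T| (isT : 0 < 2240).
    rewrite -/p => e1 e2; apply: leq_trans (_ : 4480 * p <= _); first lia.
    by rewrite leq_mul2r orbT.
  have pR : (0 < p%:R :> R)%R by rewrite ltr0n; lia.
  have H := diff (fun s => sample_valid (G s) p) (p%:R^-1 * (6 * l%:R))%R.
  have H1 : (n`!%:R <= 4 * (p%:R^-1 * (6 * l%:R) * S))%R.
    apply: H => [||s sv nb].
    - by rewrite !mulr_ge0 ?invr_ge0.
    - apply: le_trans (sample_valid_sum R Fdc TF _ pT) _; first by lia.
      apply: ler_sum => s _; rewrite /sample_valid rainbow_ext_pull imset0.
      by rewrite -/(block_length n p).
    - rewrite -mulrA ler_pdivlMl // mulr1 -!natrM ler_nat mulnC.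
      by apply: gain_large nb p4 sv _; lia.
  have TpR : (#|T|%:R <= 2 ^+ 13 * p%:R :> R)%R by rewrite -natrX -natrM ler_nat.
  have H2 : (p%:R * n`!%:R <= 24 * (l%:R * S))%R.
    rewrite -ler_pdivlMl //; apply: le_trans H1 _.
    by rewrite le_eqVlt; apply/orP; left; apply/eqP; ring.
  apply: le_trans (ler_wpM2r (ltW fn) TpR) _.
  have e18 : (2 ^+ 18 = 2 ^+ 13 * 2 ^+ 5 :> R)%R by rewrite -exprD.
  rewrite -(mulrA (2 ^+ 13)%R) -(mulrA (2 ^+ 18)%R) e18 -(mulrA (2 ^+ 13)%R) ler_pM2l ?exprn_gt0 //.
  apply: le_trans H2 _; rewrite ler_wpM2r ?mulr_ge0 //.
  by rewrite !exprS expr0; lra.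
have [T0|[x xT]] := set_0Vmem T.
  by rewrite T0 cards0 mul0r !mulr_ge0.
have xF : [set x] \in F by apply: Fdc.2 TF; rewrite sub1set.
have H := diff _ 1%R ler01 (late_sum x).
have H1 : (n`!%:R <= 4 * (1 * S))%R.
  apply: H => s /existsP[t /andP[ht /eqP st]] nb.
  by rewrite mul1r ler1n; apply: gain_pos nb ht _; rewrite st.
have kR : (#|T|%:R <= 2 ^+ 14 :> R)%R.
  by rewrite -natrX ler_nat; apply: leq_trans (ltnW kT) _.
apply: le_trans (ler_pM _ _ kR H1) _; rewrite ?ler0n //.
have e18 : (2 ^+ 18 = 2 ^+ 14 * 2 ^+ 4 :> R)%R by rewrite -exprD.
rewrite mul1r -(mulrA (2 ^+ 18)%R) e18 -(mulrA (2 ^+ 14)%R) ler_pM2l ?exprn_gt0 //.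
apply: le_trans (_ : 4 * (l%:R * S) <= _)%R.
  by rewrite ler_pM2l // ler_peMl.
rewrite ler_wpM2r ?mulr_ge0 //.
by rewrite !exprS expr0; lra.
Qed.

Lemma ratio_bound : (instance_ratio (block_algorithm R) I <= (2 ^+ 18 * l%:R)%:E)%E.
Proof.
have [T TF optT] := opt_value_feasible_ones.
have := gain_sum TF; set S := (\sum_s _)%R => TS.
have fn : (0 < n`!%:R :> R)%R by rewrite ltr0n fact_gt0.
have S0 : (0 <= S)%R by apply: sumr_ge0 => s _; exact: ler0n.
have c0 : (0 <= 2 ^+ 18 * l%:R :> R)%R by rewrite mulr_ge0 ?exprn_ge0.
have EV : expected_value (block_algorithm R) I = (S / n`!%:R)%R.
  by congr (_ / _)%R; apply: eq_bigr => s _; rewrite alg_value_gain.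
rewrite /instance_ratio EV.
have opt0 : (0 <= opt_value I)%R by apply: bigmax_ge_id.
(* With optimum 0 the ratio is 0 whatever the denominator. Otherwise [S] is positive and the
   extended division is the real one. *)
case: (posnP #|T|) => [T0|Tpos].
  have -> : opt_value I = 0%R by apply: le_anti; rewrite opt0 (le_trans optT) ?T0.
  by rewrite mul0e lee_fin.
have Spos : (0 < S)%R.
  rewrite lt_neqAle S0 andbT eq_sym; apply/eqP => Se; move: TS; rewrite Se mulr0.
  by apply/negP; rewrite -ltNge mulr_gt0 // ltr0n.
rewrite inver gt_eqF ?divr_gt0 // -EFinM lee_fin invf_div mulrA.
rewrite ler_pdivrMr //; apply: le_trans TS; rewrite ler_wpM2r //; exact: ltW.
Qed.

End Performance.

Theorem theorem3p2 (R : realType) :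
  exists A : online_algorithm R,
    (forall (n : nat) (I : instance R n), binary I -> keeps_feasible A I) /\
    exists C : R, (0 < C)%R /\
      forall n : nat, (2 <= n)%N ->
        (competitive_ratio A (@binary R n) <= (C * ln (n%:R))%:E)%E.
Proof.
exists (block_algorithm R); split=> [n I _|]; first exact: block_algorithm_feasible.
have ln2 : (0 < ln 2 :> R)%R by apply: ln_gt0; rewrite ltr1n.
exists (2 ^+ 18 * (2 / ln 2))%R; split; first by rewrite mulr_gt0 ?exprn_gt0 ?divr_gt0.
move=> n n2; apply: ge_ereal_sup => _ [I Ibin <-].
(* For n >= 2 the truncated logarithm is at least 1, so [l] is at most twice it, hence at most 2 ln
   n / ln 2. *)
pose l := (trunc_log 2 n).+1.
have n0 : 0 < n by apply: ltnW.
have nl : n <= 2 ^ l by apply: ltnW; apply: trunc_log_ltn.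
apply: le_trans (ratio_bound Ibin n0 (ltn0Sn _) nl) _.
rewrite lee_fin -(mulrA (2 ^+ 18)%R) ler_pM2l ?exprn_gt0 //.
have t0 : 0 < trunc_log 2 n by rewrite trunc_log_gt0.
have tln : ((trunc_log 2 n)%:R * ln 2 <= ln n%:R :> R)%R.
  rewrite mulr_natl -lnXn // ler_ln ?posrE ?exprn_gt0 ?ltr0n //.
  by rewrite -natrX ler_nat trunc_logP.
apply: (@le_trans _ _ (2 * (trunc_log 2 n)%:R)%R).
  by rewrite -natrM ler_nat /l; lia.
by rewrite -(mulrA 2%R) ler_pM2l // mulrC ler_pdivlMr.
Qed.
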